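(* Let $q$ be an odd prime power, $t\ge3$ an integer, $\sigma=q^J$ with $J\in\{1,\ldots,2t-1\}$ and $\gcd(J,2t)=1$. Let $E=\{x\in\mathbb{F}_{q^{2t}}\colon x^{q^t}+x=0\}$, $E^*=E\setminus\{0\}$, let $m$ be a $(\sigma+1)$-power of an element of $E^*$, and let $\phi=X^{\sigma^{t-1}}+X^{\sigma^{2t-1}}+m(X^\sigma-X^{\sigma^{t+1}})\in\mathbb{F}_{q^{2t}}[X]$. (i) If $t$ is odd, then $L_\phi$ is projectively equivalent to a linear set $L_U$ in $\mathrm{PG}(1,q^{2t})$ with $$U=\{(u+\xi u^{q^s},v+\xi\mu v^{q^s})\colon u,v\in\mathbb{F}_{q^t}\},$$ for some positive integer $s$ coprime with $t$, some $\mu\in\mathbb{F}_{q^t}^*$ and $\xi\in\mathbb{F}_{q^{2t}}\setminus\mathbb{F}_{q^t}$ such that $\mathrm{N}_{q^t/q}(\mu)\ne1$ and $\mathrm{N}_{q^t/q}(-\xi^{q^t+1}\mu)\ne(-1)^t$. Hence, $L_\phi$ is a $(2,t)$-regular fat linear set in $\mathrm{PG}(1,q^{2t})$. (ii) If $t$ is even, then $L_\phi$ is projectively equivalent to a linear set $L_{T^2}$ in $\mathrm{PG}(1,q^{2t})$ with $T=\{x+wx^{q^s}\colon x\in I\}$, for some positive integer $s$ coprime with $t$, some $w\in E^*$ with $\mathrm{N}_{q^t/q}(w^2)\ne(-1)^t$, and some $\mathbb{F}_q$-subspace $I$ of $\mathbb{F}_{q^t}$ of dimension at least two. Hence, $L_\phi$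 is a $(q+1,t)$-regular fat linear set in $\mathrm{PG}(1,q^{2t})$.
   Context: $\mathrm{N}_{q^t/q}(x)=x^{(q^t-1)/(q-1)}$ for $x\in\mathbb{F}_{q^t}$. For an $\mathbb{F}_q$-subspace $U$ of $\mathbb{F}_{q^{2t}}^2$, $L_U=\{\langle v\rangle_{\mathbb{F}_{q^{2t}}}\colon v\in U,\ v\neq0\}\subseteq\mathrm{PG}(1,q^{2t})$, and the weight of a point $P=\langle v\rangle_{\mathbb{F}_{q^{2t}}}$ is $\dim_{\mathbb{F}_q}(\langle v\rangle_{\mathbb{F}_{q^{2t}}}\cap U)$. For an $\mathbb{F}_q$-linearized polynomial $f$ over $\mathbb{F}_{q^{2t}}$, $L_f=L_{U_f}$ with $U_f=\{(x,f(x))\colon x\in\mathbb{F}_{q^{2t}}\}$. $T^2=T\times T$. Projectively equivalent means lying in the same orbit under $\mathrm{PGL}(2,q^{2t})$. For integers $r\ge0$, $i\ge2$, a linear set is $(r,i)$-regular fat if it has exactly $r$ points of weight $i$, all its remaining points have weight one, and there is at least one point of weight one. *)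

(* Defs.v *)
From HB Require Import structures.
From mathcomp Require Import all_boot all_order all_algebra all_fingroup all_solvable all_field.
Set Implicit Arguments.
Unset Strict Implicit.
Unset Printing Implicit Defensive.
Import GRing.Theory.
Local Open Scope ring_scope.

(* K plays the role of F_q, with q = #|K|, and L that of F_(q^n), n = \dim {:L}. *)
Section LinearSets.
Variables (K : finFieldType) (L : fieldExtType K).
Implicit Types (U V : {vspace L * L}) (A I : {vspace L}) (v w : L * L).

Local Notation q := #|K|.

Lemma expq_linear k : linear (fun x : L => x ^+ (q ^ k)).
Proof.
have [p pr_p pK] := finPcharP K.
have pL : p \in [pchar L] by rewrite pchar_lalg.
have nat_q : [pchar L].-nat (q ^ k)%N.
  rewrite pnatX (eq_pnat _ (pcharf_eq pL)) -cardsT; apply/orP; left.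
  by have /abelem_pgroup := fin_ring_pchar_abelem pK.
move=> a x y; rewrite exprDn_pchar // exprZn; congr (_ *: _ + _).
by elim: k {nat_q} => [|k IHk]; rewrite ?expr1 // expnS exprM expf_card.
Qed.

(* The one-dimensional L-subspace spanned by v, seen as a K-subspace of L^2. *)
Definition Lline_fun v (a : L) : L * L := (a * v.1, a * v.2).

Lemma Lline_fun_linear v : linear (Lline_fun v).
Proof.
by move=> k a b; rewrite /Lline_fun !mulrDl -!scalerAl.
Qed.
HB.instance Definition _ v :=
  GRing.isLinear.Build K L (L * L)%type *:%R (Lline_fun v) (Lline_fun_linear v).

Definition Lline v : {vspace L * L} := limg (linfun (Lline_fun v)).

Lemma mem_Lline v w : w \in Lline v <-> exists a : L, w = (a * v.1, a * v.2).
Proof.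
split=> [/memv_imgP[a _ ->]|[a ->]]; first by exists a; rewrite lfunE.
by apply/memv_imgP; exists a; rewrite ?memvf // lfunE.
Qed.

(* Points of PG(1, L) are the K-spaces Lline v with v != 0; a set of points is
   a predicate on {vspace L * L}. *)
Definition linear_set U (P : {vspace L * L}) : Prop :=
  exists v, [/\ v \in U, v != 0 & P = Lline v].

Definition weight U (P : {vspace L * L}) : nat := \dim (P :&: U).

Definition mx_fun (M : 'M[L]_2) v : L * L :=
  (M 0 0 * v.1 + M 0 1 * v.2, M 1 0 * v.1 + M 1 1 * v.2).

Lemma mx_fun_linear M : linear (mx_fun M).
Proof.
by move=> k v w; congr (_, _); rewrite /= !mulrDr -!scalerAr scalerDr addrACA.
Qed.
HB.instance Definition _ M :=
  GRing.isLinear.Build K (L * L)%type (L * L)%type *:%R (mx_fun M)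
    (mx_fun_linear M).

Lemma mx_fun_Lline M v :
  (linfun (mx_fun M) @: Lline v)%VS = Lline (mx_fun M v).
Proof.
rewrite /Lline -limg_comp; congr (limg _); apply/lfunP=> a.
rewrite comp_lfunE !lfunE /= /mx_fun /Lline_fun /=.
by rewrite !mulrDr !(mulrCA a).
Qed.

Definition proj_equiv (S S' : {vspace L * L} -> Prop) : Prop :=
  exists2 M : 'M[L]_2, M \in unitmx &
    forall P, S' P <-> exists2 Q, S Q & P = (linfun (mx_fun M) @: Q)%VS.

Definition exactly (r : nat) (S : {vspace L * L} -> Prop) : Prop :=
  exists s : seq {vspace L * L},
    [/\ uniq s, size s = r & forall P, P \in s <-> S P].

Definition regular_fat (r i : nat) U : Prop :=
  [/\ (2 <= i)%N,
      exactly r (fun P => linear_set U P /\ weight U P = i),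
      forall P, linear_set U P -> weight U P <> i -> weight U P = 1%N
    & exists P, linear_set U P /\ weight U P = 1%N].

Definition linearized (f : {poly L}) : Prop :=
  forall j, f`_j != 0 -> exists k, j = (q ^ k)%N.

(* U_f = {(x, f(x))}; it is only meaningful for linearized f, because linfun is
   junk on functions that are not K-linear (see mem_graph). *)
Definition graph (f : {poly L}) : {vspace L * L} :=
  limg (linfun (fun x : L => (x, f.[x]))).

Lemma linearized_linear f : linearized f -> linear (horner f).
Proof.
move=> lin_f a x y; rewrite !horner_coef scaler_sumr -big_split /=.
apply: eq_bigr => j _; have [->|/lin_f[k ->]] := eqVneq f`_j 0.
  by rewrite !mul0r scaler0 addr0.
by rewrite expq_linear mulrDr scalerAr.
Qed.

Lemma linfun_linearE (aT rT : vectType K) (f : aT -> rT) :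
  linear f -> linfun f =1 f.
Proof.
move=> lin_f; pose ff := GRing.isLinear.Build K aT rT *:%R f lin_f.
pose g : {linear aT -> rT} := HB.pack f ff; exact: (lfunE g).
Qed.

Lemma mem_graph f w : linearized f -> w \in graph f <-> exists x, w = (x, f.[x]).
Proof.
move=> /linearized_linear lin_f.
have lin_g : linear (fun x : L => (x, f.[x])).
  by move=> a x y; rewrite lin_f.
split=> [/memv_imgP[x _ ->]|[x ->]]; first by exists x; rewrite linfun_linearE.
by apply/memv_imgP; exists x; rewrite ?memvf // linfun_linearE.
Qed.

(* The subfield F_(q^t) of L (when t divides the degree of L over K). *)
Definition subfieldq (t : nat) : {vspace L} :=
  fixedSpace (linfun (fun x : L => x ^+ (q ^ t))).

Lemma mem_subfieldq t x : x \in subfieldq t <-> x ^+ (q ^ t) = x.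
Proof.
have E := linfun_linearE (expq_linear t).
by split=> [/fixedSpaceP|Ex]; [|apply/fixedSpaceP]; rewrite E.
Qed.

Definition antifixed (t : nat) (x : L) : Prop := x ^+ (q ^ t) + x = 0.

(* N_(q^t/q), as a power map on all of L. *)
Definition relnorm (t : nat) (x : L) : L := x ^+ ((q ^ t).-1 %/ q.-1).

(* {x + c x^(q^s) : x \in A} *)
Definition twist (s : nat) (c : L) A : {vspace L} :=
  (linfun (fun x : L => x + c * x ^+ (q ^ s)) @: A)%VS.

Lemma mem_twist s c A y :
  y \in twist s c A <-> exists2 x, x \in A & y = x + c * x ^+ (q ^ s).
Proof.
have lin_g : linear (fun x : L => x + c * x ^+ (q ^ s)).
  by move=> a x z; rewrite expq_linear mulrDr scalerDr -scalerAr addrACA.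
split=> [/memv_imgP[x Ax ->]|[x Ax ->]].
  by exists x; rewrite ?linfun_linearE.
by apply/memv_imgP; exists x; rewrite ?linfun_linearE.
Qed.

Definition cartv A I : {vspace L * L} :=
  ((linfun fst @^-1: A) :&: (linfun snd @^-1: I))%VS.

Lemma mem_cartv A I w : (w \in cartv A I) = (w.1 \in A) && (w.2 \in I).
Proof. by rewrite memv_cap -!memv_preim !lfunE. Qed.

Definition phi_poly (t J : nat) (m : L) : {poly L} :=
  let sigma := (q ^ J)%N in
  'X^(sigma ^ t.-1) + 'X^(sigma ^ (2 * t).-1)
    + m *: ('X^sigma - 'X^(sigma ^ t.+1)).

Lemma phi_poly_linearized t J m : linearized (phi_poly t J m).
Proof.
move=> j; rewrite !coefE -!expnM.
have [->|_] := eqVneq j (q ^ (J * t.-1))%N; first by exists (J * t.-1)%N.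
have [->|_] := eqVneq j (q ^ (J * (2 * t).-1))%N; first by exists (J * (2 * t).-1)%N.
have [->|_] := eqVneq j (q ^ J)%N; first by exists J.
have [->|_] := eqVneq j (q ^ (J * t.+1))%N; first by exists (J * t.+1)%N.
by rewrite subr0 mulr0 !addr0 eqxx.
Qed.

End LinearSets.

(* Main.v *)
Require Import Defs.
From HB Require Import structures.
From mathcomp Require Import all_boot all_order all_algebra all_fingroup all_solvable all_field.
From mathcomp Require Import ring.
Set Implicit Arguments.
Unset Strict Implicit.
Unset Printing Implicit Defensive.
Import GRing.Theory.
Local Open Scope ring_scope.

(** Write F for the fixed field of x |-> x^(q^t), so that L = F + eF, and write
    sg for x |-> x^(q^J), a generator of the Galois group of L over K.  As J is
    odd, sg^t is the conjugation a + be |-> a - be of L over F.  Hence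
    phi(x) = sg^(t-1)(x + conj x) + m sg(x - conj x), and putting
    2x = sg(alpha) + gamma / e with alpha, gamma in F gives
    phi(x) = alpha + e sg(gamma), because m = e sg(e).  Thus the vectors
    (2ex, phi(x)) are (gamma + e sg(alpha), alpha + e sg(gamma)), and the sum and
    difference of their coordinates are u + e sg(u) and v - e sg(v) with
    u = gamma + alpha and v = gamma - alpha arbitrary in F.  So the graph of phi
    is projectively equivalent to
      W = {(u + e sg(u), v - e sg(v)) : u, v in F}      ([phi_graph_img]),
    the form claimed for odd t, with s = J, xi = e and mu = -1.

    Everything about norms follows from one fact: N(e)^q = -N(e), as
    e^(q^t) = -e ([norm_anti]).  In particular N(e)^2 is a nonsquare of K, so it
    is not 1 ([norm_sqr_neq1]).  Moreover, for even t, rho = N(e) is an element of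
    F with sg(rho) = -rho, and dividing the second coordinate of W by rho turns
    its second factor into the first one, which is the form claimed for even t,
    with I = F and w = e.

    The weights are computed on W for both parities at once.  A point of slope
    alpha + beta e (alpha, beta in F) gives, for each vector of W on it, a
    solution u in F of
      beta u + (alpha + sg(alpha)) sg(u) + sg(e^2 beta) sg^2(u) = 0
    ([slope_eq]).  Two solutions that are independent over K have a nonzero Moore
    determinant D = u sg(u') - u' sg(u), and the equation yields
    beta D = sg(e^2 beta D).  Taking norms gives N(e^2) = 1 unless beta = 0
    ([norm_obstruction]), and then sg(alpha) = -alpha.  So a point has weight one
    unless its slope is infinite or an alpha of F with sg(alpha) = -alpha
    ([fat_model_dichotomy]); these exceptional points do have weight t
    ([fat_point_weight]).  The equation sg(alpha) = -alpha forces alpha = 0 if t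
    is odd, and its solutions are the K-multiples of rho if t is even, which
    leaves 2, respectively q + 1, points of weight t ([fat_points_exactly]). *)

(** * Frobenius powers and norms *)

Section Frobenius.
Variables (K : finFieldType) (L : fieldExtType K).
Implicit Types (x y : L) (j k n t : nat).

Definition Frob k x : L := x ^+ (#|K| ^ k).

Lemma Frob_zmod_morphism k : zmod_morphism (Frob k).
Proof.
move=> x y; rewrite -scaleN1r addrC.
by rewrite [LHS](expq_linear k) scaleN1r addrC.
Qed.
HB.instance Definition _ k :=
  GRing.isZmodMorphism.Build L L (Frob k) (Frob_zmod_morphism k).

Lemma Frob_monoid_morphism k : monoid_morphism (Frob k).
Proof. by split=> [|x y]; rewrite /Frob ?expr1n ?exprMn. Qed.
HB.instance Definition _ k :=
  GRing.isMonoidMorphism.Build L L (Frob k) (Frob_monoid_morphism k).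

Lemma FrobD j k x : Frob j (Frob k x) = Frob (k + j) x.
Proof. by rewrite /Frob -exprM expnD. Qed.

Lemma FrobC j k x : Frob j (Frob k x) = Frob k (Frob j x).
Proof. by rewrite !FrobD addnC. Qed.

Lemma Frob_fixM k i x : Frob k x = x -> Frob (k * i) x = x.
Proof.
move=> fx; elim: i => [|i IH]; first by rewrite muln0 /Frob expr1.
by rewrite mulnS -FrobD fx.
Qed.

Lemma Frob_antifixM k i x : Frob k x = - x -> Frob (k * i) x = (-1) ^+ i * x.
Proof.
move=> fx; elim: i => [|i IH]; first by rewrite muln0 mul1r /Frob expr1.
by rewrite mulnS -FrobD fx rmorphN /= IH exprS mulN1r mulNr.
Qed.

Lemma Frob_dim x : Frob (\dim {:L}) x = x.
Proof. by apply/eqP; rewrite -Fermat's_little_theorem memvf. Qed.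

Lemma Frob1_fixed x : Frob 1 x = x -> x \in 1%VS.
Proof.
move=> fx; have := Fermat's_little_theorem 1%AS x.
by rewrite dimv1 => ->; apply/eqP.
Qed.

Lemma Frob_scalar k (a : K) : Frob k a%:A = a%:A :> L.
Proof.
have := Fermat's_little_theorem (1%AS : {subfield L}) a%:A.
rewrite dimv1 rpredZ ?mem1v // => /esym/eqP fa.
by rewrite -[k]mul1n (Frob_fixM k fa).
Qed.

(** A power of the generator x |-> x^q with exponent prime to the degree is
    again a generator of the Galois group, by Bezout. *)
Lemma Frob_coprime_fixed k x :
  coprime k (\dim {:L}) -> Frob k x = x -> x \in 1%VS.
Proof.
move=> cop fx; have [k0|k_gt0] := posnP k.
  apply: Frob1_fixed; move: cop; rewrite k0 /coprime gcd0n => /eqP <-.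
  exact: Frob_dim.
have [u v def_u _] := egcdnP (\dim {:L}) k_gt0.
move: def_u; rewrite (eqnP cop) mulnC (mulnC v) => def_u.
apply: Frob1_fixed; rewrite -{2}(Frob_fixM u fx) def_u -FrobD.
by rewrite (Frob_fixM v (Frob_dim x)).
Qed.

(** The exponent is the sum of the t odd powers q^i, for i < t. *)
Lemma relnorm_exp_parity t :
  odd #|K| -> odd ((#|K| ^ t).-1 %/ #|K|.-1) = odd t.
Proof.
have := finNzRing_gt1 K; move: #|K| => q q_gt1 q_odd.
rewrite predn_exp mulKn; last by case: q q_gt1 {q_odd} => [|[]].
elim: t => [|t IH]; first by rewrite big_ord0.
by rewrite big_ord_recr /= oddD IH oddX q_odd orbT addbT.
Qed.

Lemma relnormM t x y : relnorm t (x * y) = relnorm t x * relnorm t y.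
Proof. exact: exprMn. Qed.

(** Raising N(x) = x^(1 + q + ... + q^(t-1)) to the power q replaces the
    factor x by x^(q^t). *)
Lemma relnorm_Frob t x : Frob 1 (relnorm t x) * x = relnorm t x * Frob t x.
Proof.
have q_gt0 : (0 < #|K|)%N by apply: ltnW (finNzRing_gt1 K).
have -> : Frob 1 (relnorm t x) = relnorm t x * relnorm t x ^+ #|K|.-1.
  by rewrite -exprS prednK // /Frob expn1.
rewrite -mulrA; congr (_ * _).
rewrite /relnorm -exprM divnK ?predn_exp ?dvdn_mulr // -predn_exp -exprSr.
by rewrite prednK // expn_gt0 q_gt0.
Qed.

Lemma relnorm_neq0 t x : x != 0 -> relnorm t x != 0.
Proof. exact: expf_neq0. Qed.

Lemma two_neq0 : odd #|K| -> (2 : L) != 0.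
Proof.
move=> q_odd; apply/negP=> two0.
have pL2 : 2 \in [pchar L] by rewrite inE.
have pK2 : 2 \in [pchar K] by rewrite -(pchar_lalg L).
have : (2%N : nat_pred).-nat #|K|.
  have /abelem_pgroup := fin_ring_pchar_abelem pK2.
  by rewrite /pgroup cardsT.
case/p_natP=> -[|k] def_q; have := finNzRing_gt1 K; move: q_odd; rewrite def_q //.
by rewrite oddX.
Qed.

End Frobenius.

(** * Projectivities and weights *)

Section Projectivities.
Variables (K : finFieldType) (L : fieldExtType K).
Implicit Types (U P Q : {vspace L * L}) (M : 'M[L]_2) (v w : L * L).

Lemma mx_funM M N v : mx_fun M (mx_fun N v) = mx_fun (M *m N) v.
Proof.
rewrite /mx_fun /= !mxE !big_ord_recr !big_ord0 /= !add0r.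
have -> : widen_ord (leqnSn 1) ord_max = 0 :> 'I_2 by apply/val_inj.
have -> : ord_max = 1 :> 'I_2 by apply/val_inj.
by congr (_, _); ring.
Qed.

Lemma mx_fun1 v : mx_fun 1%:M v = v.
Proof. by rewrite /mx_fun !mxE /= !mul1r !mul0r addr0 add0r; case: v. Qed.

Lemma lker_mx_fun M : M \in unitmx -> lker (linfun (mx_fun M)) == 0%VS.
Proof.
move=> uM; apply/lker0P=> v w; rewrite !lfunE /= => /(congr1 (mx_fun (invmx M))).
by rewrite !mx_funM mulVmx // !mx_fun1.
Qed.

Lemma mx_fun_imgK M U : M \in unitmx ->
  (linfun (mx_fun (invmx M)) @: (linfun (mx_fun M) @: U))%VS = U.
Proof.
move=> uM; rewrite -limg_comp -[RHS]lim1g; congr (_ @: _)%VS.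
by apply/lfunP=> v; rewrite comp_lfunE !lfunE /= mx_funM mulVmx // mx_fun1.
Qed.

Lemma linear_set_img M U P : M \in unitmx ->
  linear_set (linfun (mx_fun M) @: U) P <->
  exists2 Q, linear_set U Q & P = (linfun (mx_fun M) @: Q)%VS.
Proof.
move=> uM; have inj_M := lker0P (lker_mx_fun uM); split.
  case=> _ [/memv_imgP[v Uv ->] nzv ->]; rewrite lfunE /= in nzv *.
  exists (Lline v); last by rewrite mx_fun_Lline.
  by exists v; split=> //; apply: contraNneq nzv => ->; rewrite raddf0.
case=> _ [v [Uv nzv ->]] ->; exists (mx_fun M v); split.
- by apply/memv_imgP; exists v; rewrite ?lfunE.
- apply: contraNneq nzv => Mv0; apply/eqP/inj_M.
  by rewrite linear0 lfunE.
- exact: mx_fun_Lline.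
Qed.

Lemma weight_img M U P : M \in unitmx ->
  weight (linfun (mx_fun M) @: U) (linfun (mx_fun M) @: P) = weight U P.
Proof.
move=> uM; have ker0 := lker_mx_fun uM; rewrite /weight.
have -> : (linfun (mx_fun M) @: P :&: linfun (mx_fun M) @: U =
           linfun (mx_fun M) @: (P :&: U))%VS.
  apply/vspaceP=> w; apply/idP/idP; last first.
    by apply/subvP/limg_cap.
  rewrite memv_cap => /andP[/memv_imgP[v Pv ->] /memv_imgP[u Uu]].
  move/(lker0P ker0)=> def_v; apply: memv_img.
  by rewrite memv_cap Pv def_v.
by apply: limg_dim_eq; rewrite (eqP ker0) capv0.
Qed.

Lemma regular_fat_img M U r i : M \in unitmx ->
  regular_fat r i U -> regular_fat r i (linfun (mx_fun M) @: U).
Proof.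
move=> uM [i_ge2 [s [uniq_s size_s mem_s]] other [P1 [UP1 wP1]]].
set g := linfun (mx_fun M).
have inj_g : injective (fun Q => g @: Q)%VS.
  by move=> Q R /(congr1 (fun V => linfun (mx_fun (invmx M)) @: V)%VS);
     rewrite !mx_fun_imgK.
split=> //.
- exists [seq (g @: Q)%VS | Q <- s]; split; rewrite ?map_inj_uniq ?size_map //.
  move=> P; split.
    case/mapP=> Q /mem_s[UQ wQ] ->; split; last by rewrite weight_img.
    by apply/(linear_set_img _ _ uM); exists Q.
  case=> /(linear_set_img _ _ uM)[Q UQ ->]; rewrite weight_img // => wQ.
  by apply/mapP; exists Q => //; apply/mem_s.
- move=> P /(linear_set_img _ _ uM)[Q UQ ->]; rewrite weight_img //.
  exact: other.
exists (g @: P1)%VS; rewrite weight_img //; split=> //.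
by apply/(linear_set_img _ _ uM); exists P1.
Qed.

Lemma Lline_inj v : v != 0 -> injective (Lline_fun v).
Proof.
case: v => v1 v2 nzv a b [] /= /eqP; rewrite -subr_eq0 -mulrBl mulf_eq0 subr_eq0.
case/orP=> [/eqP //|/eqP v10] /eqP.
rewrite -subr_eq0 -mulrBl mulf_eq0 subr_eq0 => /orP[/eqP //|/eqP v20].
by case/eqP: nzv; rewrite v10 v20.
Qed.

Lemma Lline_scale (c : L) v w : c != 0 -> w = Lline_fun v c -> Lline w = Lline v.
Proof.
move=> nzc ->; apply/vspaceP=> w'; apply/idP/idP; case/mem_Lline=> a ->.
  by apply/mem_Lline; exists (a * c); rewrite -!mulrA.
by apply/mem_Lline; exists (a / c); rewrite /= !mulrA divfK.
Qed.

Lemma Lline_slope_inj (a b : L) : Lline (1, a) = Lline (1, b) -> a = b.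
Proof.
move=> eq_ab; have : (1, a) \in Lline (1, a).
  by apply/mem_Lline; exists 1; rewrite !mul1r.
by rewrite eq_ab => /mem_Lline[c /= []]; rewrite mulr1 => <-; rewrite mul1r.
Qed.

Lemma Lline_infty_slope (a : L) : Lline (0, 1) <> Lline (1, a).
Proof.
move=> eq_a; have : (1, a) \in Lline (0, 1).
  by rewrite eq_a; apply/mem_Lline; exists 1; rewrite !mul1r.
case/mem_Lline=> c /= []; rewrite mulr0 => /eqP; by rewrite oner_eq0.
Qed.

(** Parametrizing the point by a |-> a v identifies its intersection with U
    with a subspace A of L. *)
Lemma weight_LlineE U v (A : {vspace L}) : v != 0 ->
  (forall a, Lline_fun v a \in U <-> a \in A) -> weight U (Lline v) = \dim A.
Proof.
move=> nzv UA; rewrite /weight.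
have -> : (Lline v :&: U = linfun (Lline_fun v) @: A)%VS.
  apply/vspaceP=> w; apply/idP/idP.
    rewrite memv_cap => /andP[/memv_imgP[a _ ->]]; rewrite lfunE => /UA Aa.
    by apply/memv_imgP; exists a; rewrite ?lfunE.
  case/memv_imgP=> a /UA Ua ->; rewrite memv_cap lfunE Ua andbT.
  by apply/memv_imgP; exists a; rewrite ?memvf ?lfunE.
apply: limg_dim_eq.
suff /eqP-> : lker (linfun (Lline_fun v)) == 0%VS by rewrite capv0.
by apply/lker0P=> a b; rewrite !lfunE => /(Lline_inj nzv).
Qed.

End Projectivities.

Section LinearCombination.
Variable R : pzRingType.

(** Linear combinations of hypotheses, in a form that leaves one ring identity
    to check. *)
Lemma eq_comb1 (l r : R) (c A B : R) : l = r -> A - B = c * (l - r) -> A = B.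
Proof. by move=> -> /eqP; rewrite subrr mulr0 subr_eq0 => /eqP. Qed.

Lemma eq_comb2 (l r l' r' : R) (c c' A B : R) :
  l = r -> l' = r' -> A - B = c * (l - r) + c' * (l' - r') -> A = B.
Proof. by move=> -> -> /eqP; rewrite !subrr !mulr0 addr0 subr_eq0 => /eqP. Qed.

End LinearCombination.

(** * The model linear set *)

Section FatLinearSet.
Variables (K : finFieldType) (L : fieldExtType K) (t J : nat) (e : L).
Hypotheses (q_odd : odd #|K|) (t_ge3 : (3 <= t)%N).
Hypotheses (dimL : \dim {:L} = (2 * t)%N) (cop_J : coprime J (2 * t)).
Hypotheses (e_anti : Frob t e = - e) (e_neq0 : e != 0).

Local Notation F := (subfieldq L t).
Local Notation sg := (Frob J).
Local Notation N := (relnorm t).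
Implicit Types (x y u v a b alpha beta lambda : L).

Let two_n0 : (2 : L) != 0 := two_neq0 L q_odd.

Lemma oppr_eq_self x : - x = x -> x = 0.
Proof.
move=> /eqP; rewrite eq_sym -subr_eq0 opprK -mulr2n -mulr_natl mulf_eq0.
by rewrite (negPf two_n0) => /eqP.
Qed.

Lemma odd_J : odd J.
Proof. by move: cop_J; rewrite coprimeMr coprimen2 => /andP[]. Qed.

Lemma memF x : x \in F <-> Frob t x = x.
Proof. exact: mem_subfieldq. Qed.

Lemma FrobF k x : Frob t x = x -> Frob t (Frob k x) = Frob k x.
Proof. by rewrite FrobC => ->. Qed.

Lemma sg_fixed x : sg x = x -> x \in 1%VS.
Proof. by apply: Frob_coprime_fixed; rewrite dimL. Qed.

Lemma scalar_fixed k x : x \in 1%VS -> Frob k x = x.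
Proof. by case/vlineP=> c ->; apply: Frob_scalar. Qed.

(** L is the direct sum of F and eF: apply x |-> x^(q^t), which changes the
    sign of e. *)
Lemma split_eq a b a' b' :
  Frob t a = a -> Frob t b = b -> Frob t a' = a' -> Frob t b' = b' ->
  a + b * e = a' + b' * e -> a = a' /\ b = b'.
Proof.
move=> fa fb fa' fb' E; have := congr1 (Frob t) E.
rewrite !rmorphD !rmorphM /= fa fb fa' fb' e_anti !mulrN => E'.
have Ea : a = a'.
  by apply: (mulfI two_n0); apply: (eq_comb2 (c := 1) (c' := 1) E E'); ring.
by split=> //; move: E; rewrite Ea => /addrI/(mulIf e_neq0).
Qed.

Lemma split_ex x : exists a b,
  [/\ Frob t a = a, Frob t b = b & x = a + b * e].
Proof.
have fxx : Frob t (Frob t x) = x by rewrite FrobD addnn -mul2n -dimL Frob_dim.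
have f2 : Frob t (2 : L) = 2 by rewrite rmorph_nat.
exists ((x + Frob t x) / 2), ((x - Frob t x) / (2 * e)); split.
- by rewrite fmorph_div rmorphD /= fxx f2 addrC.
- rewrite fmorph_div rmorphB rmorphM /= fxx f2 e_anti.
  by field; rewrite ?two_n0 ?e_neq0 ?oppr_eq0.
- by field; rewrite ?two_n0 ?e_neq0.
Qed.

(** The map x |-> x^(q^t) - x has kernel F and image eF. *)
Lemma dimF : \dim F = t.
Proof.
pose g : 'End(L) := linfun (Frob t) - \1%VF.
have lin_f x : (linfun (Frob t) : 'End(L)) x = Frob t x.
  exact: (linfun_linearE (expq_linear t)).
have gE x : g x = Frob t x - x by rewrite add_lfunE opp_lfunE id_lfunE lin_f.
have kerg : lker g = F by [].
have img : limg g = (amulr e @: F)%VS.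
  apply/vspaceP=> y; apply/idP/idP.
    case/memv_imgP=> x _ ->; have [a [b [fa fb ->]]] := split_ex x.
    apply/memv_imgP; exists (- 2 * b).
      by apply/memF; rewrite rmorphM rmorphN rmorph_nat /= fb.
    rewrite gE lfunE /= rmorphD rmorphM /= fa fb e_anti; ring.
  case/memv_imgP=> b /memF fb ->; apply/memv_imgP.
  exists (- (b * e / 2)); first exact: memvf.
  rewrite gE lfunE /= rmorphN !rmorphM fmorphV rmorph_nat /= fb e_anti.
  by field.
have := limg_ker_dim g fullv; rewrite capfv kerg img limg_dim_eq; last first.
  have /eqP-> : lker (amulr e) == 0%VS.
    by apply/lker0P=> x y; rewrite !lfunE; apply: mulIf.
  by rewrite capv0.
by rewrite dimL addnn -mul2n => /eqP; rewrite eqn_pmul2l // => /eqP.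
Qed.

Lemma twist_injective c u :
  c = e \/ c = - e -> Frob t u = u -> u + c * sg u = 0 -> u = 0.
Proof.
move=> c_e fu u0; have f0 : Frob t (0 : L) = 0 by rewrite rmorph0.
case: c_e u0 => -> u0.
  apply: (proj1 (@split_eq u (sg u) 0 0 fu (FrobF J fu) f0 f0 _)).
  by apply: (eq_comb1 (c := 1) u0); ring.
have fsu : Frob t (- sg u) = - sg u by rewrite rmorphN /= FrobF.
apply: (proj1 (@split_eq u (- sg u) 0 0 fu fsu f0 f0 _)).
by apply: (eq_comb1 (c := 1) u0); ring.
Qed.

Lemma dim_twist c : (c = e \/ c = - e) -> \dim (twist J c F) = t.
Proof.
move=> c_e; rewrite -[RHS]dimF; apply: limg_dim_eq.
apply/eqP; rewrite -subv0; apply/subvP=> u; rewrite memv_cap memv_ker.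
have lin_c : linear (fun x : L => x + c * x ^+ (#|K| ^ J)).
  by move=> a x z; rewrite expq_linear mulrDr scalerDr -scalerAr addrACA.
rewrite (linfun_linearE lin_c) -/(Frob J u) memv0 => /andP[/memF fu /eqP u0].
exact/eqP/(twist_injective c_e fu).
Qed.

Lemma fixed_norm x k : Frob t x = x -> Frob k (N x) = N x.
Proof.
move=> fx; have [->|nzx] := eqVneq x 0.
  rewrite /relnorm expr0n; case: (_ == _); first by rewrite rmorph1.
  by rewrite rmorph0.
rewrite -[k]mul1n; apply: Frob_fixM; apply: (mulIf nzx).
by rewrite relnorm_Frob fx.
Qed.

Lemma norm_anti : Frob 1 (N e) = - N e.
Proof.
by apply: (mulIf e_neq0); rewrite relnorm_Frob e_anti mulrN mulNr.
Qed.

Lemma norm_anti_neq0 : N e != 0.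
Proof. exact: relnorm_neq0. Qed.

(** The sign change N(e)^q = -N(e) survives the odd number J of iterations.
    For even t, N(e) lies in F, and the existence of such an element of F is
    an instance of Hilbert's Theorem 90. *)
Lemma sg_norm_anti : sg (N e) = - N e.
Proof.
by rewrite -[J]mul1n (Frob_antifixM J norm_anti) -signr_odd odd_J mulN1r.
Qed.

Lemma norm_sqr_neq1 : N e ^+ 2 != 1.
Proof.
apply/negP; rewrite sqrf_eq1 => /orP[]/eqP N1; have := norm_anti.
  by rewrite N1 rmorph1 => /esym/oppr_eq_self/eqP; rewrite oner_eq0.
by rewrite N1 rmorphN1 => /esym/oppr_eq_self/eqP; rewrite oppr_eq0 oner_eq0.
Qed.

(** Norms of elements of F lie in K, so they are fixed by sg; the equation
    then says N(x) = N(e)^2 N(x). *)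
Lemma norm_obstruction x : Frob t x = x -> x = sg (e ^+ 2 * x) -> x = 0.
Proof.
move=> fx def_x; apply/eqP; apply: contraNT norm_sqr_neq1 => nzx.
have fex : Frob t (e ^+ 2 * x) = e ^+ 2 * x.
  by rewrite rmorphM rmorphXn /= fx e_anti sqrrN.
have : N x = N (e ^+ 2 * x).
  rewrite {1}def_x -[RHS](fixed_norm J fex).
  by rewrite /relnorm rmorphXn.
rewrite relnormM -{1}[N x]mul1r => /(mulIf (relnorm_neq0 t nzx)) N1.
by rewrite [X in _ == X]N1 /relnorm -!exprM mulnC.
Qed.

(** Comparing the components in F and eF gives v = alpha u + e^2 beta sg(u)
    and -sg(v) = beta u + alpha sg(u); eliminate v. *)
Lemma slope_eq alpha beta u v :
    Frob t alpha = alpha -> Frob t beta = beta ->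
    Frob t u = u -> Frob t v = v ->
    (alpha + beta * e) * (u + e * sg u) = v - e * sg v ->
  beta * u + (alpha + sg alpha) * sg u + sg (e ^+ 2 * beta) * sg (sg u) = 0.
Proof.
move=> fal fbe fu fv E.
have fsu := FrobF J fu; have fsv := FrobF J fv.
have fe2 : Frob t (e ^+ 2) = e ^+ 2 by rewrite rmorphXn /= e_anti sqrrN.
have [Ev Esv] : alpha * u + e ^+ 2 * beta * sg u = v /\
    beta * u + alpha * sg u = - sg v.
  apply: split_eq.
  - rewrite rmorphD /= [Frob t (alpha * u)]rmorphM [Frob t (_ * sg u)]rmorphM /=.
    by rewrite [Frob t (_ * beta)]rmorphM /= fe2 fal fbe fu fsu.
  - by rewrite rmorphD !rmorphM /= fal fbe fu fsu.
  - exact: fv.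
  - by rewrite rmorphN /= fsv.
  - by apply: (eq_comb1 (c := 1) E); ring.
have : beta * u + alpha * sg u = - sg (alpha * u + e ^+ 2 * beta * sg u).
  by rewrite Ev.
rewrite rmorphD /= [sg (alpha * u)]rmorphM [sg (_ * sg u)]rmorphM /= => E2.
by apply: (eq_comb1 (c := 1) E2); ring.
Qed.

(** The Moore determinant D of u and u' vanishes only if u'/u is in K, and
    then lambda = u'/u. Otherwise eliminating the middle term of the two slope
    equations gives beta D = sg(e^2 beta D). *)
Lemma slope_dichotomy alpha beta u u' v v' lambda :
    Frob t alpha = alpha -> Frob t beta = beta ->
    Frob t u = u -> Frob t v = v -> Frob t u' = u' -> Frob t v' = v' ->
    u != 0 ->
    (alpha + beta * e) * (u + e * sg u) = v - e * sg v ->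
    (alpha + beta * e) * (u' + e * sg u') = v' - e * sg v' ->
    lambda * (u + e * sg u) = u' + e * sg u' ->
  lambda \in 1%VS \/ beta = 0 /\ sg alpha = - alpha.
Proof.
move=> fal fbe fu fv fu' fv' nzu E E' El.
have S := slope_eq fal fbe fu fv E; have S' := slope_eq fal fbe fu' fv' E'.
pose D := u * sg u' - u' * sg u.
have sgD : sg D = sg u * sg (sg u') - sg u' * sg (sg u).
  by rewrite rmorphB !rmorphM.
have [D0|nzD] := eqVneq D 0.
  left; have nzsu : sg u != 0 by rewrite fmorph_eq0.
  have k1 : u' / u \in 1%VS.
    apply: sg_fixed; rewrite fmorph_div /=; apply/eqP.
    by rewrite eqr_div // mulrC -subr_eq0 -/D D0.
  suff -> : lambda = u' / u by [].
  have nzy : u + e * sg u != 0.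
    apply: contraNneq nzu => y0.
    by apply/eqP/(twist_injective (or_introl erefl) fu).
  apply: (mulIf nzy); rewrite El; have := scalar_fixed J k1.
  rewrite fmorph_div /= => /(canRL (divfK nzsu)) ->.
  by field.
right; have bD : beta * D = 0.
  apply: norm_obstruction.
    by rewrite rmorphM rmorphB !rmorphM /= fbe fu fu' !FrobF.
  (* These coefficients cancel the sg(u) sg(u') terms of the two equations. *)
  rewrite mulrA [RHS]rmorphM /= sgD {1}/D.
  by apply: (eq_comb2 (c := sg u') (c' := - sg u) S S'); ring.
have be0 : beta = 0 by apply/eqP; rewrite -(mulIr_eq0 _ (mulIf nzD)) bD.
split=> //; move: S; rewrite be0 mul0r mulr0 rmorph0 mul0r add0r addr0.
by move/eqP; rewrite mulf_eq0 fmorph_eq0 (negPf nzu) orbF addrC addr_eq0 => /eqP.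
Qed.

Definition fat_model : {vspace L * L} :=
  cartv (twist J e F) (twist J (- e) F).
Local Notation W := fat_model.

Lemma mem_fat_model w : w \in W <-> exists u v,
  [/\ Frob t u = u, Frob t v = v & w = (u + e * sg u, v - e * sg v)].
Proof.
rewrite mem_cartv; split.
  case/andP=> /mem_twist[u /memF fu Eu] /mem_twist[v /memF fv Ev].
  by exists u, v; split; rewrite // [w]surjective_pairing Eu Ev mulNr.
case=> u [v [fu fv ->]]; apply/andP; split; apply/mem_twist.
  by exists u => //; apply/memF.
by exists v; [apply/memF | rewrite mulNr].
Qed.

Definition fat_point (P : {vspace L * L}) : Prop :=
  P = Lline (0, 1) \/
  exists alpha, [/\ Frob t alpha = alpha, sg alpha = - alpha
                  & P = Lline (1, alpha)].

(** If sg(alpha) = -alpha, then alpha (u + e sg(u)) = v - e sg(v) with v =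
    alpha u, so multiplication by alpha sends the first factor of W into the
    second one, and the whole first factor is seen on the point of slope
    alpha. *)
Lemma fat_point_weight P : fat_point P -> linear_set W P /\ weight W P = t.
Proof.
have f0 : Frob t (0 : L) = 0 by rewrite rmorph0.
have f1 : Frob t (1 : L) = 1 by rewrite rmorph1.
have s1 : sg (1 : L) = 1 by rewrite rmorph1.
case=> [->|[al [fal sal ->]]].
  have y_n0 : 1 - e != 0.
    apply/eqP=> /subr0_eq e1; move: e_anti; rewrite -e1 rmorph1.
    by move/esym/oppr_eq_self/eqP; rewrite oner_eq0.
  split.
    exists (0, 1 - e); split.
    - apply/mem_fat_model; exists 0, 1; split=> //.
      by rewrite s1 rmorph0 mulr0 addr0 mulr1.
    - by apply: contraNneq y_n0 => -[->].
    by apply/esym/(Lline_scale y_n0); rewrite /Lline_fun /= mulr0 mulr1.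
  rewrite -[RHS](dim_twist (or_intror (erefl (- e)))); apply: weight_LlineE.
    by apply/eqP=> -[/eqP]; rewrite oner_eq0.
  move=> a; rewrite mem_cartv /Lline_fun /= mulr0 mem0v mulr1; by split.
have y_n0 : 1 + e != 0.
  apply: contraNneq (oner_neq0 L) => y0.
  by apply/eqP/(twist_injective (or_introl erefl) f1); rewrite s1 mulr1.
split.
  exists (1 + e, al * (1 + e)); split.
  - apply/mem_fat_model; exists 1, al; split; rewrite // ?s1 ?sal; congr (_, _).
      by rewrite mulr1.
    by ring.
  - by apply: contraNneq y_n0 => -[->].
  by apply/esym/(Lline_scale y_n0); rewrite /Lline_fun /= mulr1 mulrC.
rewrite -[RHS](dim_twist (or_introl (erefl e))); apply: weight_LlineE.
  by apply/eqP=> -[/eqP]; rewrite oner_eq0.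
move=> a; rewrite mem_cartv /Lline_fun /= mulr1; split=> [/andP[]//|Ta].
rewrite Ta /=; have /mem_twist[u /memF fu ->] := Ta.
apply/mem_twist; exists (al * u).
  by apply/memF; rewrite rmorphM /= fal fu.
by rewrite -/(sg u) -/(sg (al * u)) rmorphM /= sal; ring.
Qed.

Lemma fat_model_dichotomy P :
  linear_set W P -> fat_point P \/ weight W P = 1%N.
Proof.
case=> w [Ww nzw ->]; have /mem_fat_model[u [v [fu fv def_w]]] := Ww.
have [u0|nzu] := eqVneq u 0.
  left; left; move: nzw; rewrite def_w u0 rmorph0 mulr0 addr0 => nzw.
  have nzy : v - e * sg v != 0 by apply: contraNneq nzw => ->.
  by apply: (Lline_scale nzy); rewrite /Lline_fun /= mulr0 mulr1.
set y1 := u + e * sg u in def_w; set y2 := v - e * sg v in def_w.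
have nzy1 : y1 != 0.
  by apply: contraNneq nzu => /(twist_injective (or_introl erefl) fu) ->.
have [al [be [fal fbe def_th]]] := split_ex (y2 / y1).
have slope : (al + be * e) * y1 = y2 by rewrite -def_th divfK.
have line_w : Lline w = Lline (1, al + be * e).
  by apply: (Lline_scale nzy1); rewrite def_w /Lline_fun /= mulr1 mulrC slope.
have [fat|nfat] := eqVneq (be, sg al) (0, - al).
  left; right; exists al; case: fat line_w => be0 sal ->.
  by rewrite be0 mul0r addr0.
right; rewrite -[RHS](dimv1 L); apply: weight_LlineE => // a; split.
  case/mem_fat_model=> u' [v' [fu' fv']]; rewrite def_w => -[E1 E2].
  have slope' : (al + be * e) * (u' + e * sg u') = v' - e * sg v'.
    by rewrite -E1 -E2 -slope; ring.
  have [] // := slope_dichotomy fal fbe fu fv fu' fv' nzu slope slope' E1.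
  by case=> be0 sal; case/eqP: nfat; rewrite be0 sal.
case/vlineP=> k ->; suff -> : Lline_fun w k%:A = k *: w by apply: memvZ.
by case: w {Ww nzw def_w line_w} => w1 w2; rewrite /Lline_fun /= !mulr_algl.
Qed.

Lemma fat_points_exactly :
  exactly (if odd t then 2 else #|K|.+1) fat_point.
Proof.
have t_gt0 : (0 < t)%N by apply: leq_trans t_ge3.
pose rho := N e.
have sal_k (k : K) : sg (k%:A * rho) = - (k%:A * rho).
  by rewrite rmorphM /= Frob_scalar sg_norm_anti mulrN.
have sgt (al : L) : Frob t al = al -> sg al = - al -> (-1) ^+ t * al = al.
  by move=> fal sal; rewrite -(Frob_antifixM t sal) mulnC Frob_fixM.
have inf_slope al : Lline (0 : L, 1) != Lline (1, al).
  by apply/eqP; apply: Lline_infty_slope.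
case: ifPn => t_par.
  exists [:: Lline (0, 1); Lline (1, 0)]; split=> //.
    by rewrite /= inE inf_slope.
  move=> P; rewrite !inE; split.
    case/orP=> /eqP ->; [by left | right; exists 0].
    by rewrite !rmorph0 oppr0.
  case=> [->|[al [fal sal ->]]]; first by rewrite eqxx.
  have := sgt al fal sal; rewrite -signr_odd t_par mulN1r => /oppr_eq_self ->.
  by rewrite eqxx orbT.
have f_rho : Frob t rho = rho.
  by rewrite -[t]mul1n (Frob_antifixM t norm_anti) -signr_odd (negPf t_par) mul1r.
exists (Lline (0, 1) :: [seq Lline (1, k%:A * rho) | k <- enum K]); split.
- rewrite /= map_inj_uniq ?enum_uniq ?andbT.
    by apply/mapP=> -[k _]; apply: Lline_infty_slope.
  move=> k k' /Lline_slope_inj/(mulIf norm_anti_neq0)/eqP.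
  by rewrite -subr_eq0 -scalerBl scaler_eq0 oner_eq0 orbF subr_eq0 => /eqP.
- by rewrite /= size_map -cardE.
move=> P; rewrite inE; split.
  case/orP=> [/eqP->|/mapP[k _ ->]]; [by left | right; exists (k%:A * rho)].
  by split; rewrite ?sal_k // rmorphM /= Frob_scalar f_rho.
case=> [->|[al [fal sal ->]]]; first by rewrite eqxx.
apply/orP; right; apply/mapP.
have /vlineP[k def_k] : al / rho \in 1%VS.
  by apply: sg_fixed; rewrite fmorph_div /= sal sg_norm_anti invrN mulrNN.
by exists k; rewrite ?mem_enum // -def_k divfK ?norm_anti_neq0.
Qed.

(** The point of weight one is the one through u = v = 1: its slope (1 - e) /
    (1 + e) is finite, and a slope alpha in F would give both alpha = 1 and
    alpha = -1. *)
Lemma regular_fat_model :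
  regular_fat (if odd t then 2 else #|K|.+1) t W.
Proof.
have t_gt1 : (1 < t)%N by apply: leq_trans t_ge3.
split=> //.
- have [s [uniq_s size_s mem_s]] := fat_points_exactly.
  exists s; split=> // P; rewrite mem_s; split; first exact: fat_point_weight.
  case=> /fat_model_dichotomy[//|w1] wt; move: t_gt1.
  by rewrite -wt w1.
- by move=> P /fat_model_dichotomy[/fat_point_weight[]|].
have f1 : Frob t (1 : L) = 1 by rewrite rmorph1.
have s1 : sg (1 : L) = 1 by rewrite rmorph1.
have nzy : 1 + e != 0.
  apply: contraNneq (oner_neq0 L) => y0.
  by apply/eqP/(twist_injective (or_introl erefl) f1); rewrite s1 mulr1.
have WP : linear_set W (Lline (1 + e, 1 - e)).
  exists (1 + e, 1 - e); split=> //; last by apply: contraNneq nzy => -[->].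
  by apply/mem_fat_model; exists 1, 1; rewrite s1 mulr1.
exists (Lline (1 + e, 1 - e)); split=> //.
case: (fat_model_dichotomy WP) => // fatP.
have : (1 + e, 1 - e) \in Lline (1 + e, 1 - e).
  by apply/mem_Lline; exists 1; rewrite !mul1r.
case: fatP => [->|[al [fal sal ->]]] /mem_Lline[c /= []].
  by rewrite mulr0 => /eqP; rewrite (negPf nzy).
rewrite mulr1 => <- E.
have fN1 : Frob t (-1 : L) = -1 by rewrite rmorphN1.
have [al1 alN1] : 1 = al /\ -1 = al.
  by apply: split_eq => //; apply: (eq_comb1 (c := 1) E); ring.
have /eqP := oppr_eq_self (etrans alN1 (esym al1)).
by rewrite oner_eq0.
Qed.

(** * The graph of phi *)

Section PhiGraph.
Variable m : L.
Hypothesis m_def : m = e ^+ (#|K| ^ J + 1).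

Lemma phi_eval x : (phi_poly t J m).[x] =
  Frob (J * t.-1) x + Frob (J * (2 * t).-1) x + m * (sg x - Frob (J * t.+1) x).
Proof. by rewrite /phi_poly !hornerE /Frob -!expnM. Qed.

Lemma Frob_Jt x : Frob (J * t) x = Frob t x.
Proof.
rewrite -(odd_double_half J) odd_J mulnDl mul1n addnC -FrobD; congr (Frob t _).
have -> : (J./2.*2 * t = 2 * t * J./2)%N by rewrite -mul2n mulnAC.
rewrite -dimL; exact/Frob_fixM/Frob_dim.
Qed.

(** As sg^t is x |-> x^(q^t), the four terms of phi pair up into the trace and
    the antitrace of x over F. *)
Lemma phi_eval_split x :
  (phi_poly t J m).[x] =
    Frob (J * t.-1) (x + Frob t x) + m * sg (x - Frob t x).
Proof.
have t_gt0 : (0 < t)%N by apply: leq_trans t_ge3.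
have -> : Frob (J * t.-1) (x + Frob t x) =
          Frob (J * t.-1) x + Frob (J * (2 * t).-1) x.
  rewrite rmorphD /= -{1}Frob_Jt FrobD -mulnDr; congr (_ + Frob (J * _) x).
  by rewrite mul2n -addnn; case: (t) t_gt0 => // n _; rewrite addnS.
have -> : sg (x - Frob t x) = sg x - Frob (J * t.+1) x.
  by rewrite rmorphB /= -Frob_Jt FrobD mulnS addnC.
exact: phi_eval.
Qed.

(** The bijection of F x F with L in which phi takes a simple form. *)
Definition graph_param alpha gamma := (sg alpha + gamma / e) / 2.

Lemma phi_graph_param alpha gamma : Frob t alpha = alpha -> Frob t gamma = gamma ->
  (phi_poly t J m).[graph_param alpha gamma] = alpha + e * sg gamma.
Proof.
move=> fal fga; have t_gt0 : (0 < t)%N by apply: leq_trans t_ge3.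
have fx : Frob t (graph_param alpha gamma) = (sg alpha - gamma / e) / 2.
  rewrite fmorph_div rmorph_nat rmorphD fmorph_div /= fga e_anti FrobF //.
  by rewrite invrN mulrN.
have -> := phi_eval_split (graph_param alpha gamma); rewrite fx.
have -> : graph_param alpha gamma + (sg alpha - gamma / e) / 2 = sg alpha.
  by rewrite /graph_param; field; rewrite ?two_n0 ?e_neq0.
have -> : graph_param alpha gamma - (sg alpha - gamma / e) / 2 = gamma / e.
  by rewrite /graph_param; field; rewrite ?two_n0 ?e_neq0.
rewrite FrobD -mulnS prednK // Frob_Jt fal fmorph_div /= m_def addn1 exprSr.
rewrite -/(sg e); have nzse : sg e != 0 by rewrite fmorph_eq0.
by congr (_ + _); field.
Qed.

Lemma graph_param_surj x : exists alpha gamma,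
  [/\ Frob t alpha = alpha, Frob t gamma = gamma & x = graph_param alpha gamma].
Proof.
have [a [b [fa fb ->]]] := split_ex x.
have n_gt0 : (0 < 2 * t)%N by rewrite muln_gt0 (leq_trans _ t_ge3).
(* sg^(2t-1) is the inverse of sg. *)
exists (Frob (J * (2 * t).-1) (2 * a)), (2 * b * e ^+ 2); split.
- by rewrite FrobF // rmorphM rmorph_nat /= fa.
- by rewrite expr2 !rmorphM rmorph_nat /= fb e_anti mulrNN.
rewrite /graph_param FrobC FrobD -mulnS prednK // mulnC -dimL.
rewrite (Frob_fixM J (Frob_dim (2 * a))).
by field; rewrite ?two_n0 ?e_neq0.
Qed.

(** On the graph, 2eX and Y depend on both parameters of [graph_param]; their sum
    and difference depend on one element of F each. *)
Definition phi_proj (r : L) : 'M[L]_2 :=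
  \matrix_(i, j) (if i == 0 then (if j == 0 then 2 * e else 1)
                  else if j == 0 then 2 * e * r else - r).

Lemma phi_proj_unit r : r != 0 -> phi_proj r \in unitmx.
Proof.
move=> nzr; rewrite unitmxE unitfE (expand_det_row _ 0) !big_ord_recl big_ord0.
rewrite /cofactor !det_mx11 !mxE /= addr0.
have -> : 2 * e * (1 * - r) + 1 * (-1 ^+ 1 * (2 * e * r)) =
  - (2 * (2 * (e * r))) by ring.
by rewrite oppr_eq0 !mulf_neq0.
Qed.

(** The factor r rescales the second coordinate:
    r (v - e sg(v)) = (r v) + c sg(r v).  With r = 1 one gets c = -e, and with
    r = N(e) for even t one gets c = e. *)
Lemma phi_graph_img r c :
    Frob t r = r -> r != 0 -> c * sg r = - (e * r) ->
  (linfun (mx_fun (phi_proj r)) @: graph (phi_poly t J m))%VS =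
    cartv (twist J e F) (twist J c F).
Proof.
move=> fr nzr cr; have lin_phi : linearized (phi_poly t J m).
  exact: phi_poly_linearized.
have f2 : Frob t (2 : L) = 2 by rewrite rmorph_nat.
apply/vspaceP=> w; rewrite mem_cartv; apply/idP/idP.
  case/memv_imgP=> _ /(mem_graph _ lin_phi)[x ->] ->.
  have [al [ga [fal fga ->]]] := graph_param_surj x.
  rewrite lfunE /= phi_graph_param // /mx_fun !mxE /=.
  apply/andP; split; apply/mem_twist.
    exists (ga + al); first by apply/memF; rewrite rmorphD /= fal fga.
    rewrite -/(sg _) rmorphD /= /graph_param.
    by field; rewrite ?two_n0 ?e_neq0.
  exists (r * (ga - al)).
    by apply/memF; rewrite rmorphM rmorphB /= fr fal fga.
  rewrite -/(sg _) rmorphM /= mulrA cr rmorphB /= /graph_param.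
  by field; rewrite ?two_n0 ?e_neq0.
case/andP=> /mem_twist[u /memF fu Eu] /mem_twist[v' /memF fv' Ev'].
pose v := v' / r; have fv : Frob t v = v by rewrite fmorph_div /= fv' fr.
have def_v' : v' = r * v by rewrite mulrC divfK.
pose al := (u - v) / 2; pose ga := (u + v) / 2.
have fal : Frob t al = al by rewrite fmorph_div rmorphB /= f2 fu fv.
have fga : Frob t ga = ga by rewrite fmorph_div rmorphD /= f2 fu fv.
have s2 : sg (2 : L) = 2 by rewrite rmorph_nat.
have sal : sg al = (sg u - sg v) / 2 by rewrite fmorph_div rmorphB /= s2.
have sga : sg ga = (sg u + sg v) / 2 by rewrite fmorph_div rmorphD /= s2.
apply/memv_imgP; exists (graph_param al ga, al + e * sg ga).
  apply/(mem_graph _ lin_phi); exists (graph_param al ga).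
  by rewrite phi_graph_param.
rewrite lfunE /= /mx_fun !mxE /= [w]surjective_pairing Eu Ev' /graph_param sal sga.
rewrite -/(sg u) -/(sg v') def_v' rmorphM /= (mulrA c) cr /al /ga.
by congr (_, _); field; rewrite ?two_n0 ?e_neq0.
Qed.

Lemma graph_proj_equiv r c :
    Frob t r = r -> r != 0 -> c * sg r = - (e * r) ->
  proj_equiv (linear_set (graph (phi_poly t J m)))
             (linear_set (cartv (twist J e F) (twist J c F))).
Proof.
move=> fr nzr cr; exists (phi_proj r); first exact: phi_proj_unit.
move=> P; rewrite -(phi_graph_img fr nzr cr).
exact/linear_set_img/phi_proj_unit.
Qed.

Lemma regular_fat_graph :
  regular_fat (if odd t then 2 else #|K|.+1) t (graph (phi_poly t J m)).
Proof.
have u1 : phi_proj 1 \in unitmx by apply/phi_proj_unit/oner_neq0.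
rewrite -[graph _](mx_fun_imgK _ u1) (@phi_graph_img 1 (- e)).
- by apply: regular_fat_img; rewrite ?unitmx_inv //; apply: regular_fat_model.
- exact: rmorph1.
- exact: oner_neq0.
by rewrite rmorph1 !mulr1.
Qed.

End PhiGraph.
End FatLinearSet.

Theorem theorem4p3 (q t J : nat) (K : finFieldType) (L : fieldExtType K) (m : L)
    (hq : #|K| = q) (hodd : odd q) (ht : (3 <= t)%N)
    (hL : \dim {:L} = (2 * t)%N)
    (hJ : (1 <= J <= (2 * t).-1)%N) (hJt : coprime J (2 * t))
    (hm : exists e : L, [/\ antifixed t e, e != 0 & m = e ^+ (q ^ J + 1)]) :
  (odd t ->
    (exists (s : nat) (mu xi : L),
      [/\ (0 < s)%N /\ coprime s t,
          mu \in subfieldq L t /\ mu != 0,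
          xi \notin subfieldq L t,
          relnorm t mu != 1 /\
            relnorm t (- (xi ^+ (q ^ t + 1) * mu)) != (-1) ^+ t
        & proj_equiv (linear_set (graph (phi_poly t J m)))
            (linear_set (cartv (twist s xi (subfieldq L t))
                               (twist s (xi * mu) (subfieldq L t))))])
    /\ regular_fat 2 t (graph (phi_poly t J m)))
  /\
  (~~ odd t ->
    (exists (s : nat) (w : L) (I : {vspace L}),
      [/\ (0 < s)%N /\ coprime s t,
          antifixed t w /\ w != 0,
          relnorm t (w ^+ 2) != (-1) ^+ t,
          (I <= subfieldq L t)%VS /\ (2 <= \dim I)%N
        & proj_equiv (linear_set (graph (phi_poly t J m)))
            (linear_set (cartv (twist s w I) (twist s w I)))])
    /\ regular_fat q.+1 t (graph (phi_poly t J m))).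
Proof.
case: hm => e [e_antifixed e_neq0 def_m]; subst q.
have e_anti : Frob t e = - e by apply/eqP; rewrite -addr_eq0; apply/eqP.
have J_gt0 : (0 < J)%N by case/andP: hJ.
have cop_Jt : coprime J t by move: hJt; rewrite coprimeMr => /andP[].
have Ne2 : relnorm t (e ^+ 2) = relnorm t e ^+ 2 by rewrite !expr2 relnormM.
have N2_neq1 := norm_sqr_neq1 hodd e_anti e_neq0.
have fat := regular_fat_graph hodd ht hL hJt e_anti e_neq0 def_m.
split=> t_par; (split; last first).
- by move: fat; rewrite t_par.
- exists J, (-1), e; split=> //.
  + split; last by rewrite oppr_eq0 oner_eq0.
    by apply/mem_subfieldq; rewrite [LHS](rmorphN1 (Frob t)).
  + apply: contra e_neq0 => /mem_subfieldq e_fix.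
    apply/eqP/(oppr_eq_self hodd); rewrite -e_anti; exact: e_fix.
  + have N1 : relnorm t (-1 : L) = -1.
      by rewrite /relnorm -signr_odd relnorm_exp_parity // t_par.
    split.
      rewrite N1; apply/eqP=> /(oppr_eq_self hodd)/eqP.
      by rewrite oner_eq0.
    rewrite mulrN1 opprK addn1 exprSr -/(Frob t e) e_anti mulNr -expr2.
    rewrite -mulN1r relnormM N1 Ne2 -signr_odd t_par mulN1r.
    by rewrite eqr_opp.
  rewrite mulrN1.
  apply: (graph_proj_equiv hodd ht hL hJt e_anti e_neq0 def_m (r := 1)).
  + exact: rmorph1.
  + exact: oner_neq0.
  + by rewrite rmorph1 !mulr1.
- by move: fat; rewrite (negPf t_par).
pose rho := relnorm t e.
have rho_neq0 : rho != 0 by apply: relnorm_neq0.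
have rho_fix : Frob t rho = rho.
  rewrite -[t in Frob t]mul1n (Frob_antifixM t (norm_anti e_anti e_neq0)).
  by rewrite -signr_odd (negPf t_par) mul1r.
have s_rho : Frob J rho = - rho := sg_norm_anti hJt e_anti e_neq0.
exists J, e, (subfieldq L t); split=> //.
- by rewrite Ne2 -signr_odd (negPf t_par).
- split=> //; rewrite (dimF hodd hL e_anti e_neq0).
  exact: leq_trans ht.
apply: (graph_proj_equiv hodd ht hL hJt e_anti e_neq0 def_m rho_fix rho_neq0).
by rewrite s_rho mulrN.
Qed.
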